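(* Let $q$ be a prime power and let $\mathcal{A}$ be a combinatorially simplicial arrangement in $\mathrm{PG}(2,q)$ (i.e. a combinatorially simplicial arrangement of hyperplanes in $\mathbb{F}_q^3$, viewed as a set of projective lines). Then \[ |\mathcal{A}|\le 3q. \]
   Context: An arrangement of hyperplanes is a finite set of hyperplanes in $V=K^r$; it is central if all hyperplanes are linear subspaces, and a central arrangement is essential if the intersection of all its hyperplanes is $0$. The intersection lattice $L(\mathcal{A})$ is the set of all intersections of elements of $\mathcal{A}$ (including $V$ as the empty intersection), ordered by reverse inclusion. The characteristic polynomial is $\chi_{\mathcal{A}}(t)=\sum_{X\in L(\mathcal{A})}\mu(X)t^{\dim X}$, where $\mu(X)=\mu(V,X)$ is the Möbius function of $L(\mathcal{A})$. For $X\in L(\mathcal{A})$ the restriction is $\mathcal{A}^X=\{X\cap H\mid H\in\mathcal{A},\ X\not\subseteq H,\ X\cap H\neq\emptyset\}$, an arrangement in $X$. A finite set $\mathcal{A}$ of hyperplanes in $K^r$ is (combinatorially) simplicial if it is a central, essential arrangement satisfying $r\chi_{\mathcal{A}}(-1)+2\sum_{H\in\mathcal{A}}\chi_{\mathcal{A}^H}(-1)=0$. *)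

(* Defs.v *)
From HB Require Import structures.
From mathcomp Require Import all_boot all_order all_algebra.
From mathcomp Require Import finmap.

Set Implicit Arguments.
Unset Strict Implicit.
Unset Printing Implicit Defensive.

Import GRing.Theory.

Local Open Scope fset_scope.
Local Open Scope ring_scope.

Section Mobius.

Variables (T : choiceType) (P : {fset T}) (le : rel T).

(* The recursion mu(x, x) = 1, mu(x, z) = - \sum_(x <= y < z) mu(x, y) on the
   finite poset (P, le).  The argument n only bounds the depth of the recursion:
   it never runs out when started at #|` P|, see mobius_sum below. *)
Fixpoint mobius_rec (n : nat) (x z : T) : int :=
  if x == z then 1
  else if n is m.+1 then
    - \sum_(y <- P | [&& le x y, le y z & y != z]) mobius_rec m x y
  else 0.

Definition mobius (x z : T) : int := mobius_rec #|` P| x z.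

Lemma mobius_refl x : mobius x x = 1.
Proof. by rewrite /mobius; case: #|` P| => [|n] /=; rewrite eqxx. Qed.

Hypotheses (le_refl : reflexive le) (le_anti : antisymmetric le)
  (le_trans : transitive le).

Let below z := [fset y in P | le y z].

Let below_lt y z : z \in P -> le y z -> y != z -> (#|` below y| < #|` below z|)%N.
Proof.
move=> zP lyz nyz; apply: fproper_ltn_card; rewrite fproperE.
apply/andP; split; apply/fsubsetP.
  by move=> t; rewrite !inE => /andP[-> lty]; exact: le_trans lyz.
move=> /(_ z); rewrite !inE zP le_refl => /(_ isT) lzy.
by move/eqP: nyz; apply; apply: le_anti; rewrite lyz.
Qed.

Let mobius_rec_stable n m x z : z \in P ->
  (#|` below z| <= n)%N -> (#|` below z| <= m)%N ->
  mobius_rec n x z = mobius_rec m x z.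
Proof.
have pos t : t \in P -> (0 < #|` below t|)%N.
  by move=> tP; rewrite cardfs_gt0; apply/fset0Pn; exists t; rewrite !inE tP le_refl.
elim: n m z => [|n IHn] [|m] z zP hn hm; do ?by move: (pos z zP); rewrite ltnNge ?hn ?hm.
rewrite /=; case: eqP => // _; congr (- _).
rewrite big_seq_cond [RHS]big_seq_cond; apply: eq_bigr => y /and4P[yP _ lyz nyz].
have h := below_lt zP lyz nyz.
by apply: IHn => //; rewrite -ltnS; exact: leq_trans h _.
Qed.

Lemma mobius_sum x z : x \in P -> z \in P -> le x z -> x != z ->
  \sum_(y <- P | le x y && le y z) mobius x y = 0.
Proof.
move=> xP zP lxz nxz.
have bP t : (#|` below t| <= #|` P|)%N.
  by apply: fsubset_leq_card; apply/fsubsetP => u; rewrite !inE => /andP[].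
rewrite big_mkcond (bigD1_seq z) ?fset_uniq //= lxz le_refl /= -big_mkcondr.
rewrite {1}/mobius (@mobius_rec_stable _ #|` P|.+1) //; last exact: leqW.
rewrite /= (negPf nxz) addrC; apply/eqP; rewrite subr_eq0; apply/eqP.
by apply: eq_bigl => y; rewrite andbC andbA.
Qed.

End Mobius.

Section Arrangements.

Variables (K : fieldType) (V : vectType K).

(* A central arrangement in the subspace E of V is a finite set of linear
   hyperplanes of E.  The ambient space is a parameter because the restriction
   A^X is an arrangement in X. *)
Definition hyperplane (E H : {vspace V}) : bool :=
  (H <= E)%VS && ((\dim H).+1 == \dim E).

Definition central_arrangement (E : {vspace V}) (A : {fset {vspace V}}) : Prop :=
  forall H, H \in A -> hyperplane E H.

Definition essential (E : {vspace V}) (A : {fset {vspace V}}) : Prop :=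
  (E :&: \bigcap_(H <- A) H)%VS = 0%VS.

Definition intersection_lattice (E : {vspace V}) (A : {fset {vspace V}}) :
    {fset {vspace V}} :=
  [fset (E :&: \bigcap_(H <- B) H)%VS | B : {fset {vspace V}} in fpowerset A].

Definition reverse_inclusion : rel {vspace V} := fun X Y => (Y <= X)%VS.

Definition char_poly_arr (E : {vspace V}) (A : {fset {vspace V}}) : {poly int} :=
  let L := intersection_lattice E A in
  \sum_(X <- L) mobius L reverse_inclusion E X *: 'X^(\dim X).

(* Linear subspaces always meet, so X :&: H is never the empty set. *)
Definition restriction (A : {fset {vspace V}}) (X : {vspace V}) :
    {fset {vspace V}} :=
  [fset (X :&: H)%VS | H in A & ~~ (X <= H)%VS].

End Arrangements.

Definition combinatorially_simplicial (K : fieldType) (r : nat)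
    (A : {fset {vspace 'rV[K]_r}}) : Prop :=
  [/\ central_arrangement fullv A,
      essential fullv A
    & r%:Z * (char_poly_arr fullv A).[-1]
      + 2 * \sum_(H <- A) (char_poly_arr H (restriction A H)).[-1] = 0].

(* Main.v *)
Require Import Defs.
From HB Require Import structures.
From mathcomp Require Import all_boot all_order all_algebra.
From mathcomp Require Import finmap.
From mathcomp Require Import finfield zify ring.

(** Write q for the number of elements of K and n for the size of A.  The whole
    argument is that two values of a characteristic polynomial, one at 1 and
    one at q, together with its leading coefficients, control its value at -1.

    For an arrangement A in a space E over K, sort the vectors of E by the
    smallest flat that contains them.  A flat X has q ^ dim X vectors, so the
    value at q of the characteristic polynomial is the sum over the vectors v
    of the sum of mu over the flats containing v; by the defining property of
    the Moebius function the inner sum is 1 if v lies on no hyperplane and 0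
    otherwise.  The value at q thus counts the complement of the arrangement
    ([char_poly_arr_card]) and is nonnegative.  If the arrangement is essential
    and E is nonzero, the sum of all mu vanishes, so 1 is a root ([char_poly_arr1]).

    In dimension 2 the polynomial is t^2 + b t + c.  Having root 1 and a
    nonnegative value at q, it takes a value at most 2 (q + 1) at -1
    ([char_poly_arr_N1_dim2]); the same reasoning for t^3 - n t^2 + b t + c in
    dimension 3 bounds the value at -1 by 2 (q + 1) (q - n)
    ([char_poly_arr_N1_dim3]).  Substituting the second bound for A and the
    first one for each of its n restrictions in the simpliciality equation gives
    0 <= 6 (q + 1) (q - n) + 4 n (q + 1), that is, n <= 3 q. *)

Local Open Scope fset_scope.

(** * Flats, Moebius function and coefficients of the characteristic polynomial *)

Section Lattice.

Set Implicit Arguments.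
Unset Strict Implicit.

Lemma bigD1_seq_cond (R : Type) (idx : R) (op : Monoid.com_law idx)
    (I : eqType) (r : seq I) (j : I) (P : pred I) (F : I -> R) :
  j \in r -> uniq r -> P j ->
  \big[op/idx]_(i <- r | P i) F i =
  op (F j) (\big[op/idx]_(i <- r | P i && (i != j)) F i).
Proof.
move=> jr ur Pj; rewrite -big_filter (bigD1_seq j) ?filter_uniq ?mem_filter ?Pj //=.
by rewrite big_filter_cond.
Qed.

Import Order.TTheory GRing.Theory Num.Theory.
Local Open Scope ring_scope.

Context {K : fieldType} {V : vectType K}.
Implicit Types (E X Y Z H : {vspace V}) (A B : {fset {vspace V}}) (v : V).

Local Notation le := (@reverse_inclusion K V).

Definition flat E B : {vspace V} := (E :&: \bigcap_(H <- B) H)%VS.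

Lemma subv_flatP E B X :
  reflect ((X <= E)%VS /\ {in B, forall H, (X <= H)%VS}) (X <= flat E B)%VS.
Proof.
have -> : (X <= flat E B)%VS = (X <= E)%VS && all (fun H => X <= H)%VS B.
  rewrite subv_cap; congr (_ && _).
  by elim: (B : seq _) => [|H s IH]; rewrite ?big_nil ?subvf // big_cons subv_cap IH.
by apply: (iffP andP) => -[XE /allP].
Qed.

Lemma mem_lattice E A X :
  reflect (exists2 B, B `<=` A & X = flat E B) (X \in intersection_lattice E A).
Proof.
apply: (iffP (imfsetP _ _ _ _)) => [[B /=]|[B BA ->]].
  by rewrite fpowersetE => BA ->; exists B.
by exists B; rewrite //= fpowersetE.
Qed.

Lemma flat0 E : flat E fset0 = E.
Proof. by rewrite /flat big_seq_fset0 capvf. Qed.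

Lemma lattice_top E A : E \in intersection_lattice E A.
Proof. by apply/mem_lattice; exists fset0; rewrite ?fsub0set ?flat0. Qed.

Lemma lattice_sub E A X : X \in intersection_lattice E A -> (X <= E)%VS.
Proof. by case/mem_lattice => B _ ->; rewrite capvSl. Qed.

Lemma lattice_bot E A : essential E A -> 0%VS \in intersection_lattice E A.
Proof. by move=> eA; apply/mem_lattice; exists A. Qed.

(** The interval from E down to Z consists of the flats that contain Z, since E
    is the smallest element of the lattice; summing mu over it gives a Kronecker
    delta. *)
Lemma sum_mobius E A Z : Z \in intersection_lattice E A ->
  \sum_(X <- intersection_lattice E A | (Z <= X)%VS)
     mobius (intersection_lattice E A) le E X = (Z == E)%:R.
Proof.
set L := intersection_lattice E A => ZL.
have ETop X : X \in L -> le E X by exact: lattice_sub.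
have le_refl : reflexive le by move=> X; exact: subvv.
have le_anti : antisymmetric le.
  by move=> X Y /andP[XY YX]; apply: subv_anti; apply/andP.
have le_trans : transitive le by move=> Y X W XY YW; exact: subv_trans YW XY.
have -> : \sum_(X <- L | (Z <= X)%VS) mobius L le E X =
          \sum_(X <- L | le E X && le X Z) mobius L le E X.
  rewrite big_seq_cond [RHS]big_seq_cond; apply: eq_bigl => X.
  by case XL: (X \in L) => //=; rewrite ETop.
have [->|nZE] := eqVneq Z E; last first.
  by apply: mobius_sum => //; [exact: lattice_top|exact: ETop|rewrite eq_sym].
rewrite (@bigD1_seq_cond _ _ _ _ _ E) ?lattice_top ?fset_uniq ?le_refl ?subvv //=.
rewrite mobius_refl big1 ?addr0 //.
move=> X /andP[/andP[EX XE] /eqP[]]; apply: le_anti; exact/andP.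
Qed.

Lemma lattice_hyperplane A H : H \in A -> H \in intersection_lattice fullv A.
Proof.
move=> HA; apply/mem_lattice; exists [fset H]; first by rewrite fsub1set.
by rewrite /flat big_seq_fset1 capfv.
Qed.

(** No subspace lies strictly between a hyperplane H and the whole space, so the
    interval from fullv to H is {fullv, H} and its two values of mu cancel. *)
Lemma mobius_hyperplane A H : central_arrangement fullv A -> H \in A ->
  mobius (intersection_lattice fullv A) le fullv H = -1.
Proof.
set L := intersection_lattice fullv A => cA HA.
have /andP[_ /eqP dH] := cA H HA.
have HL : H \in L by exact: lattice_hyperplane.
have nH : H != fullv by apply: contra_eq_neq dH => ->; rewrite eqn_leq ltnn.
have := sum_mobius HL; rewrite (negPf nH).
rewrite (@bigD1_seq_cond _ _ _ _ _ H) ?fset_uniq ?subvv //=.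
rewrite (@bigD1_seq_cond _ _ _ _ _ fullv) ?fset_uniq ?lattice_top ?subvf 1?eq_sym //=.
rewrite mobius_refl big1 => [|X /andP[/andP[HX nXH] nXf]].
  by rewrite addr0 => /eqP; rewrite addr_eq0 => /eqP.
have: (\dim X <= \dim H)%N \/ (\dim (fullv : {vspace V}) <= \dim X)%N.
  by rewrite -dH; lia.
case=> dX; first by move: nXH; rewrite eq_sym eqEdim HX dX.
by move: nXf; rewrite eqEdim subvf dX.
Qed.

Lemma char_poly_arr_coef E A i : (char_poly_arr E A)`_i =
  \sum_(X <- intersection_lattice E A | \dim X == i)
     mobius (intersection_lattice E A) le E X.
Proof.
rewrite coef_sum [RHS]big_mkcond; apply: eq_bigr => X _.
by rewrite coefZ coefXn eq_sym; case: eqP; rewrite ?mulr1 ?mulr0.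
Qed.

Lemma size_char_poly_arr E A : (size (char_poly_arr E A) <= (\dim E).+1)%N.
Proof.
apply/leq_sizeP => i iE; rewrite char_poly_arr_coef big_seq_cond big1 // => X.
by case/andP => /lattice_sub/dimvS XE /eqP dX; lia.
Qed.

Lemma char_poly_arr_monic E A : (char_poly_arr E A)`_(\dim E) = 1.
Proof.
rewrite char_poly_arr_coef big_seq_cond.
rewrite (@bigD1_seq_cond _ _ _ _ _ E) ?fset_uniq ?lattice_top ?eqxx //=.
rewrite mobius_refl big1 ?addr0 // => X /andP[/andP[/lattice_sub XE /eqP dX]].
by rewrite eqEdim XE dX leqnn.
Qed.

(** The flats of codimension 1 are exactly the members of A: such a flat is
    contained in some member of A, which has the same dimension.  Each of them
    has mu = -1. *)
Lemma char_poly_arr_coef_hyperplanes A d :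
  \dim (fullv : {vspace V}) = d.+1 -> central_arrangement fullv A ->
  (char_poly_arr fullv A)`_d = - (#|` A|)%:R.
Proof.
move=> dV cA; rewrite char_poly_arr_coef.
transitivity (\sum_(X <- A) (-1 : int)); last first.
  by rewrite big_const_seq count_predT iter_addr_0 mulNrn.
rewrite -big_filter [LHS](perm_big A); last first.
  apply: uniq_perm; rewrite ?filter_uniq ?fset_uniq // => X.
  rewrite mem_filter; apply/andP/idP => [[/eqP dX /mem_lattice[B BA eX]]|XA].
    have [B0|[H HB]] := fset_0Vmem B.
      by move: dX; rewrite eX B0 flat0 dV => /eqP; rewrite eqn_leq ltnn.
    have HA := fsubsetP BA H HB; have /andP[_] := cA H HA.
    rewrite dV => /eqP[dH].
    suff -> : X = H by [].
    apply/eqP; rewrite eqEdim dX dH leqnn andbT.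
    have /subv_flatP[_ h] : (X <= flat fullv B)%VS by rewrite eX subvv.
    exact: h.
  have /andP[_] := cA X XA; rewrite dV => /eqP[->]; split => //.
  exact: lattice_hyperplane.
by apply: eq_big_seq => X XA; exact: mobius_hyperplane.
Qed.

(** The value at 1 is the sum of mu over the whole lattice, which for an
    essential arrangement is the interval ending at the zero space. *)
Lemma char_poly_arr1 E A : essential E A -> E != 0%VS ->
  (char_poly_arr E A).[1] = 0.
Proof.
move=> eA E0; rewrite horner_sum.
under eq_bigr do rewrite hornerZ hornerXn expr1n mulr1.
have := sum_mobius (lattice_bot eA); rewrite eq_sym (negPf E0) => s0.
by rewrite -[RHS]s0; apply: eq_bigl => X; rewrite sub0v.
Qed.

(** The members of A that contain H are absent from the restriction, but they do
    not shrink the intersection inside H. *)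
Lemma essential_restriction A H :
  essential fullv A -> essential H (restriction A H).
Proof.
move=> eA; apply/eqP; rewrite -subv0 -[X in (_ <= X)%VS]eA.
have /subv_flatP[SH S] := subvv (flat H (restriction A H)).
apply/subv_flatP; split=> [|G GA]; first exact: subvf.
have [HG|nHG] := boolP (H <= G)%VS; first exact: subv_trans HG.
have: (H :&: G)%VS \in restriction A H.
  by apply/imfsetP; exists G; rewrite //= inE GA.
by move/S; rewrite subv_cap => /andP[].
Qed.

End Lattice.

(** * Arrangements over a finite field *)

Section FiniteField.

Set Implicit Arguments.
Unset Strict Implicit.

Import Order.TTheory GRing.Theory Num.Theory.
Local Open Scope ring_scope.

Context {K : finFieldType} {V : vectType K}.
Implicit Types (E X H : {vspace V}) (A : {fset {vspace V}}).

(** Destructing V exposes the packed form of the vector space in which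
    [card_vspace] counts the vectors of a subspace. *)
Lemma card_finvect X :
  #|[pred v : finvect_type V | v \in X]| = (#|K| ^ \dim X)%N.
Proof.
case: V X => T c X.
exact: (@card_vspace K (finvect_type (Vector.Pack c)) c X).
Qed.

(** The finite field method: the number of vectors of a flat X is the value of
    t ^ dim X at q = #|K|, so that exchanging the sums over flats and vectors
    leaves, for each vector v, the sum of mu over the flats containing v. *)
Lemma char_poly_arr_card E A : {in A, forall H, ~~ (E <= H)%VS} ->
  (char_poly_arr E A).[#|K|%:R] =
  #|[pred v : finvect_type V | (v \in E) && all (fun H => v \notin H) A]|%:R.
Proof.
move=> AE; set L := intersection_lattice E A.
(* The smallest flat containing v: a flat contains v iff it contains loc v. *)
pose loc (v : V) := flat E [fset H in A | v \in H].
have locE (v : V) X : v \in E -> X \in L -> (v \in X) = (loc v <= X)%VS.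
  move=> vE /mem_lattice[B BA ->]; rewrite memvE; apply/subv_flatP/subv_flatP.
    case=> _ vB; split=> [|H HB]; first exact: capvSl.
    have /subv_flatP[_] := subvv (loc v); apply.
    by rewrite !inE (fsubsetP BA) //= memvE vB.
  case=> _ lB; split=> [|H HB]; first by rewrite -memvE.
  apply: subv_trans (lB _ HB); apply/subv_flatP; split; first by rewrite -memvE.
  by move=> G; rewrite !inE memvE => /andP[].
rewrite horner_sum.
transitivity (\sum_(X <- L) \sum_(v : finvect_type V | v \in X)
                mobius L (@reverse_inclusion K V) E X).
  apply: eq_bigr => X _; rewrite hornerZ hornerXn sumr_const.
  by rewrite card_finvect -natrX mulr_natr.
rewrite (exchange_big_dep xpredT) //= -sum1_card natr_sum [RHS]big_mkcond /=.
apply: eq_bigr => v _; rewrite inE; case: (boolP (v \in E)) => vE; last first.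
  rewrite big_seq_cond big1 // => X /andP[/lattice_sub/subvP XE /XE].
  by rewrite (negPf vE).
have lL : loc v \in L.
  apply/mem_lattice; exists [fset H in A | v \in H] => //.
  by apply/fsubsetP => H; rewrite !inE => /andP[].
transitivity (\sum_(X <- L | (loc v <= X)%VS)
                mobius L (@reverse_inclusion K V) E X).
  rewrite big_seq_cond [RHS]big_seq_cond; apply: eq_bigl => X.
  by case XL: (X \in L); rewrite //= (locE v X).
rewrite (sum_mobius lL) /=.
transitivity ((all (fun H => v \notin H) A)%:R : int); last by case: all.
congr (_%:R); congr (nat_of_bool _).
rewrite eqEsubv capvSl /=; apply/subv_flatP/allP => [[_ lE] H HA|nA].
  by apply/negP => vH; move/negP: (AE H HA); apply; apply: lE; rewrite !inE HA.
by split=> // H; rewrite !inE => /andP[/nA/negP].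
Qed.

Lemma card_field_gt1 : (1 < #|K|%:R :> int).
Proof. by rewrite ltr1n finNzRing_gt1. Qed.

(** After division by t - 1 only a linear polynomial remains; its value at q is
    nonnegative, and this is a lower bound for b, hence an upper bound for the
    value -2 b of the quadratic at -1. *)
Lemma quadratic_bound (q b c : int) : 1 < q ->
  c + b + 1 = 0 -> 0 <= c + b * q + q ^+ 2 -> c - b + 1 <= 2 * (q + 1).
Proof.
move=> q1 root1; have -> : c = - b - 1 by lia.
have -> : - b - 1 + b * q + q ^+ 2 = (q - 1) * (q + 1 + b) by ring.
by rewrite pmulr_rge0 ?subr_gt0 // => bound; lia.
Qed.

(** As in [quadratic_bound]: with root 1, twice the value at q of the quotient
    by t - 1 is exactly the gap in the claimed bound on the value at -1. *)
Lemma cubic_bound (q n b c : int) : 1 < q ->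
  c + b - n + 1 = 0 -> 0 <= c + b * q - n * q ^+ 2 + q ^+ 3 ->
  c - b - n - 1 <= 2 * (q + 1) * (q - n).
Proof.
move=> q1 root1; have -> : c = n - b - 1 by lia.
have -> : n - b - 1 + b * q - n * q ^+ 2 + q ^+ 3
          = (q - 1) * (b + (q ^+ 2 + q + 1 - n * (q + 1))) by ring.
rewrite pmulr_rge0 ?subr_gt0 // => bound; rewrite -subr_ge0.
have -> : 2 * (q + 1) * (q - n) - (n - b - 1 - b - n - 1)
          = 2 * (b + (q ^+ 2 + q + 1 - n * (q + 1))) by ring.
exact: mulr_ge0.
Qed.

Lemma char_poly_arr_N1_dim2 E A : \dim E = 2%N -> essential E A ->
  {in A, forall H, ~~ (E <= H)%VS} ->
  (char_poly_arr E A).[-1] <= 2 * (#|K|%:R + 1).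
Proof.
move=> dE eA AE; have nE : E != 0%VS by rewrite -dimv_eq0 dE.
have root1 := char_poly_arr1 eA nE.
have : 0 <= (char_poly_arr E A).[#|K|%:R] by rewrite char_poly_arr_card.
have := char_poly_arr_monic E A; have := size_char_poly_arr E A; move: root1.
rewrite dE; set p := char_poly_arr E A => root1 sp p2; move: root1.
rewrite !(horner_coef_wide _ sp) !big_ord_recr !big_ord0 /= p2.
rewrite !(expr0, expr1, expr1n, sqrrN, mulr1, mul1r, add0r, mulrN).
exact/quadratic_bound/card_field_gt1.
Qed.

Lemma char_poly_arr_N1_dim3 A : \dim (fullv : {vspace V}) = 3%N ->
  central_arrangement fullv A -> essential fullv A ->
  (char_poly_arr fullv A).[-1] <= 2 * (#|K|%:R + 1) * (#|K|%:R - #|` A|%:R).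
Proof.
move=> dE cA eA.
have AE : {in A, forall H, ~~ (fullv <= H)%VS}.
  by move=> H /cA /andP[_ /eqP dH]; apply/negP => /dimvS; rewrite -dH ltnn.
have nE : (fullv : {vspace V}) != 0%VS by rewrite -dimv_eq0 dE.
have root1 := char_poly_arr1 eA nE.
have : 0 <= (char_poly_arr fullv A).[#|K|%:R] by rewrite char_poly_arr_card.
have := char_poly_arr_coef_hyperplanes dE cA.
have := char_poly_arr_monic fullv A; have := size_char_poly_arr fullv A.
move: root1; rewrite dE; set p := char_poly_arr _ A => root1 sp p3 p2; move: root1.
rewrite !(horner_coef_wide _ sp) !big_ord_recr !big_ord0 /= p2 p3.
have -> : (-1) ^+ 3 = -1 :> int by [].
rewrite !(expr0, expr1, expr1n, sqrrN, mulr1, mul1r, add0r, mulrN, mulNr).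
exact/cubic_bound/card_field_gt1.
Qed.

End FiniteField.

Theorem corollary3p2 (q : nat)
    (hq : exists p n : nat, [/\ prime p, 0 < n & q = p ^ n])
    (K : finFieldType) (hK : #|K| = q)
    (A : {fset {vspace 'rV[K]_3}}) (hA : combinatorially_simplicial A) :
  #|` A| <= 3 * q.
Proof.
case: hA => cA eA simp.
have d3 : \dim (fullv : {vspace 'rV[K]_3}) = 3 by rewrite dimvf /dim /= mul1n.
have bA := char_poly_arr_N1_dim3 d3 cA eA.
have bH : (\sum_(H <- A) (char_poly_arr H (restriction A H)).[-1]
  <= \sum_(H <- A) 2 * (#|K|%:R + 1))%R.
  rewrite big_seq [leRHS]big_seq; apply: Num.Theory.ler_sum => H HA.
  apply: char_poly_arr_N1_dim2; last first.
  - move=> G /imfsetP[F] /=; rewrite !inE => /andP[_ nHF] ->.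
    by rewrite subv_cap subvv.
  - exact: essential_restriction.
  by have /andP[_] := cA H HA; rewrite d3 eqSS => /eqP.
(* Both bounds go into the simpliciality equation, whose common factor q + 1 is
   then cancelled. *)
move: simp bA bH; rewrite hK big_const_seq count_predT.
rewrite GRing.iter_addr_0 -GRing.mulr_natr.
have q1 : 1 < q by rewrite -hK finNzRing_gt1.
rewrite !natz.
move: (_.[-1])%R (\sum_(_ <- _) _)%R (#|` A|) => x y n.
nia.
Qed.
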